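(* Let $\mathcal X=\mathbb R^d$ (with its Borel $\sigma$-algebra) or $\mathcal X=\mathbb Z$ (with the $\sigma$-algebra of all subsets), and let $\mathcal S$ be a collection of measurable subsets of $\mathcal X$ with $\mathrm{VC}(\mathcal S)=+\infty$. Then for any $n\geq 1$, any trade-off functions $f_0$ and $f_1$ with $f_1(0)>0$, and any measurable test $\psi=\psi(X_{1:n},Y_{1:n})$, $$\mathrm{Err}_{\mathrm I}(\mathcal M_{\mathcal S};\psi)+\mathrm{Err}_{\mathrm{II}}(\mathcal M_{\mathcal S};\psi)\;\geq\;1 .$$
   Context: Trade-off functions: for probability distributions $P,Q$ on a measurable space $(\mathcal X,\mathcal A)$, $T(P,Q):[0,1]\to[0,1]$ is $T(P,Q)(\alpha)=\inf\{E_Q[1-\varphi]:\ \varphi:\mathcal X\to[0,1]\text{ measurable},\ E_P[\varphi]\leq\alpha\}$. A function $f:[0,1]\to[0,1]$ is called a trade-off function if it is convex, continuous, non-increasing and $f(\alpha)\leq 1-\alpha$ for all $\alpha\in[0,1]$. $f\succeq g$ means $f(\alpha)\geq g(\alpha)$ for all $\alpha\in[0,1]$; $f\not\succeq g$ means $f(\alpha_0)<g(\alpha_0)$ for some $\alpha_0\in[0,1]$. Testing problem: $X_{1:n}\sim P^n$ and $Y_{1:n}\sim Q^n$ are independent samples. For a test $\psi$ (a measurable $[0,1]$-valued function of the data, value $1$ meaning rejection), $(P^n\times Q^n)(\psi)$ denotes its expectation. For a set $\mathcal M$ of pairs of distributions, $\mathrm{Err}_{\mathrm I}(\mathcal M;\psi)=\sup_{(P,Q)\in\mathcal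 M:\,T(P,Q)\succeq f_0}(P^n\times Q^n)(\psi)$ and $\mathrm{Err}_{\mathrm{II}}(\mathcal M;\psi)=\sup_{(P,Q)\in\mathcal M:\,T(P,Q)\not\succeq f_1}(P^n\times Q^n)(1-\psi)$. Attainability: given a class $\mathcal S\subset\mathcal A$ containing $\emptyset$ and $\mathcal X$, a pair $(P,Q)$ is $\mathcal S$-attainable if, with $\mu=(P+Q)/2$, $p=dP/d\mu$, $q=dQ/d\mu$, for every $\lambda\in[0,\infty]$ there is $S\in\mathcal S$ with $\mathbf 1_S=\mathbf 1_{\{q>\lambda p\}}$ $\mu$-a.e. (for $\lambda=\infty$, $\mathbf 1_{\{q>\lambda p\}}$ means $\mathbf 1_{\{p=0\}}$). $\mathcal M_{\mathcal S}$ is the collection of all $\mathcal S$-attainable pairs. VC dimension: $A\subseteq\mathcal X$ (finite) is shattered by $\mathcal S$ if $\mathrm{card}\{A\cap S:S\in\mathcal S\}=2^{\mathrm{card}(A)}$; $\mathrm{VC}(\mathcal S)$ is the largest cardinality of a shattered set ($+\infty$ if arbitrarily large finite sets are shattered). *)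

(* Defs.v *)
From HB Require Import structures.
From mathcomp Require Import all_boot all_order all_algebra finmap.
From mathcomp Require Import all_classical all_reals all_analysis.

Set Implicit Arguments.
Unset Strict Implicit.
Unset Printing Implicit Defensive.

Import Order.TTheory GRing.Theory Num.Theory.
Import numFieldNormedType.Exports.

Local Open Scope classical_set_scope.
Local Open Scope ring_scope.
Local Open Scope charge_scope.

(* R^d with the Borel sigma-algebra. *)
Notation euclid R d := (g_sigma_algebraType (@open 'rV[R]_d)).

(* Z with the sigma-algebra of all subsets. *)
HB.instance Definition _ := isPointed.Build int 0.
HB.instance Definition _ := @isMeasurable.Build default_measure_display
  int discrete_measurable discrete_measurable0
  discrete_measurableC discrete_measurableU.

Section iterated_product.
Context d (T : measurableType d) (R : realType).

Definition cons_pair n (x : T * n.-tuple T) : n.+1.-tuple T :=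
  [tuple of x.1 :: x.2].

Lemma measurable_cons_pair n :
  measurable_fun [set: T * n.-tuple T] (@cons_pair n).
Proof.
exact: (measurable_cons (@measurable_fst _ _ _ _) (@measurable_snd _ _ _ _)).
Qed.

HB.instance Definition _ n :=
  isMeasurableFun.Build _ _ _ _ (@cons_pair n) (@measurable_cons_pair n).

(* P^n; characterised on rectangles by [prob_pow_rect]. *)
Fixpoint prob_pow (P : probability T R) (n : nat) :
    probability (n.-tuple T) R :=
  match n with
  | 0 => \d_ [tuple]
  | m.+1 => distribution (P \x prob_pow P m)%E (@cons_pair m)
  end.

Lemma prob_pow_rect (P : probability T R) n (A : 'I_n -> set T) :
  (forall i, measurable (A i)) ->
  prob_pow P n [set x | forall i, A i (tnth x i)] =
    (\prod_(i < n) P (A i))%E.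
Proof.
elim: n A => [A _|n IHn A mA] /=.
  by rewrite big_ord0 diracE mem_set//= => -[].
rewrite big_ord_recl /distribution /pushforward /=.
rewrite (_ : _ @^-1` _ = A ord0 `*`
    [set x : n.-tuple T | forall i, A (lift ord0 i) (tnth x i)]); last first.
  apply/seteqP; split => [[x t] /= h|[x t] /= [h0 h] i].
    split; first by have := h ord0.
    by move=> i; have := h (lift ord0 i); rewrite tnthS.
  by case: (unliftP ord0 i) => [j ->|->//]; rewrite tnthS; exact: h.
rewrite product_measure1E//; last first.
  rewrite (_ : mkset _ = \bigcap_(i in [set: 'I_n])
      (fun x : n.-tuple T => tnth x i) @^-1` A (lift ord0 i)).
    apply: fin_bigcap_measurable => // i _.
    by rewrite -[X in measurable X]setTI; exact: measurable_tnth.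
  by apply/seteqP; split => x /= h i; [move=> _|]; exact: h.
by congr (_ * _)%E; exact: (IHn (fun i => A (lift ord0 i))).
Qed.

End iterated_product.

Section mixture.
Context d (T : measurableType d) (R : realType).
Local Open Scope ereal_scope.

(* (P + Q) / 2 *)
Definition mixture (P Q : probability T R) : set T -> \bar R :=
  mscale (2^-1%R)%:nng%R (measure_add P Q).

Lemma mixtureE (P Q : probability T R) A :
  mixture P Q A = 2^-1%:E * (P A + Q A).
Proof. by rewrite -measure_addE. Qed.

HB.instance Definition _ (P Q : probability T R) :=
  Measure.on (mixture P Q).

Let mixture_setT (P Q : probability T R) : mixture P Q setT = 1.
Proof.
by rewrite mixtureE !probability_setT -EFinD -EFinM mulVf.
Qed.

HB.instance Definition _ (P Q : probability T R) :=
  Measure_isProbability.Build _ _ _ (mixture P Q) (mixture_setT P Q).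

Lemma mixture_dominatesl (P Q : probability T R) : P `<< mixture P Q.
Proof.
apply/null_content_dominatesP => A mA mA0.
move/eqP: (etrans (esym (mixtureE P Q A)) mA0); rewrite mule_eq0 eqe invr_eq0 pnatr_eq0/=.
by rewrite padde_eq0// => /andP[/eqP].
Qed.

Lemma mixture_dominatesr (P Q : probability T R) : Q `<< mixture P Q.
Proof.
apply/null_content_dominatesP => A mA mA0.
move/eqP: (etrans (esym (mixtureE P Q A)) mA0); rewrite mule_eq0 eqe invr_eq0 pnatr_eq0/=.
by rewrite padde_eq0// => /andP[_ /eqP].
Qed.

End mixture.

Section tradeoff.
Context d (T : measurableType d) (R : realType).

Definition is_test (phi : T -> R) : Prop :=
  measurable_fun [set: T] phi /\ forall x, 0 <= phi x <= 1.

Definition tradeoff (P Q : probability T R) (alpha : R) : \bar R :=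
  ereal_inf [set ('E_Q[fun x => (1 - phi x)%R])%E |
             phi in [set phi : T -> R | is_test phi /\ ('E_P[phi] <= alpha%:E)%E]].

End tradeoff.

(* The domain [0,1] is encoded by restricting every condition to `[0, 1]; the
   values of f outside it are never used. *)
Definition tradeoff_function (R : realType) (f : R -> R) : Prop :=
  [/\ forall a : R, a \in `[0, 1] -> 0 <= f a <= 1,
      convex_function (`[0, 1] : set R^o) (f : R^o -> R^o),
      {within `[0, 1], continuous f},
      {in `[0, 1] &, {homo f : a b /~ a <= b}} &
      forall a : R, a \in `[0, 1] -> f a <= 1 - a].

Definition succeq (R : realType) (F : R -> \bar R) (f : R -> R) : Prop :=
  forall a : R, a \in `[0, 1] -> ((f a)%:E <= F a)%E.

Definition nsucceq (R : realType) (F : R -> \bar R) (f : R -> R) : Prop :=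
  exists2 a : R, a \in `[0, 1] & (F a < (f a)%:E)%E.

Section testing.
Context d (T : measurableType d) (R : realType).
Variables (M : set (probability T R * probability T R)) (f : R -> R) (n : nat).
Variable psi : n.-tuple T * n.-tuple T -> R.

Definition err_I : \bar R :=
  ereal_sup [set ('E_(prob_pow PQ.1 n \x prob_pow PQ.2 n)[psi])%E |
             PQ in [set PQ | M PQ /\ succeq (tradeoff PQ.1 PQ.2) f]].

Definition err_II : \bar R :=
  ereal_sup [set ('E_(prob_pow PQ.1 n \x prob_pow PQ.2 n)
                     [fun x => (1 - psi x)%R])%E |
             PQ in [set PQ | M PQ /\ nsucceq (tradeoff PQ.1 PQ.2) f]].

End testing.

Section attainability.
Context d (T : measurableType d) (R : realType).

(* In [\bar R], +oo * 0 = 0, so lambda = +oo is treated separately. *)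
Definition lr_set (p q : T -> \bar R) (lambda : \bar R) : set T :=
  if lambda == +oo%E then [set x | p x = 0%E]
  else [set x | (lambda * p x < q x)%E].

Definition attainable (S : set (set T)) (P Q : probability T R) : Prop :=
  let mu := mixture P Q in
  let p := 'd (charge_of_finite_measure P) '/d mu in
  let q := 'd (charge_of_finite_measure Q) '/d mu in
  forall lambda : \bar R, (0 <= lambda)%E ->
    exists2 B, S B &
      {ae mu, forall x, \1_B x = \1_(lr_set p q lambda) x :> R}.

Definition attainable_pairs (S : set (set T)) :
    set (probability T R * probability T R) :=
  [set PQ | attainable S PQ.1 PQ.2].

End attainability.

Definition shattered (T : choiceType) (S : set (set T)) (A : {fset T}) : Prop :=
  ([set [set` A] `&` B | B in S] #= `I_(2 ^ #|` A|))%card.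

Definition VC_dim (R : realType) (T : choiceType) (S : set (set T)) : \bar R :=
  ereal_sup [set (#|` A|%:R)%:E | A in shattered S].

(* Main.v *)
From HB Require Import structures.
Require Import Defs.
From mathcomp Require Import all_boot all_order all_algebra finmap ring.
From mathcomp Require Import all_classical all_reals all_analysis.
From mathcomp Require Import measurable_realfun.

(** Fix a large [m]. Since the VC dimension is infinite, [2 m] distinct points
    [a (j, b)], with [j < m] and [b] a bit, are shattered by [S]. A choice of
    bits [s] splits them into two halves: let [P_s] be uniform on the points
    [a (j, s j)] and [Q_s] uniform on the points [a (j, ~~ s j)].

    - [P_s] and [Q_s] are mutually singular, so their trade-off function
      vanishes at 0 and the pair lies in the alternative. Every likelihood-ratio
      set of the pair is, up to a null set, the half carrying [Q_s], and
      shattering puts that half in [S] up to a null set.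
    - [U = (P_s + Q_s) / 2] is uniform on all the points and does not depend on
      [s]. The pair [(U, U)] lies in the null hypothesis, and its
      likelihood-ratio sets are trivial.

    A test sees [2 n] observations. As long as their indices [j] are pairwise
    distinct, the average over [s] of [P_s^n x Q_s^n] gives each possible
    outcome the mass [(2 m)^-(2 n)], exactly as [U^n x U^n] does, because the
    bits [s j] involved are independent fair coins ([birthday_mixture]). On such
    outcomes the two errors of a test add up to the common mass, which by the
    birthday bound is at least [1 - (2 n)^2 / m] ([err_sum_ge_birthday]).
    Letting [m] grow gives the theorem.

    All the laws above are finitely supported. Expectations are therefore only
    bounded below by finite sums over atoms ([expectation_ge_atoms]), and
    attainability is read off the masses of the atoms ([attainable_on_atoms]). *)

Set Implicit Arguments.
Unset Strict Implicit.
Unset Printing Implicit Defensive.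

Import Order.TTheory GRing.Theory Num.Theory.
Import numFieldNormedType.Exports.

Local Open Scope classical_set_scope.
Local Open Scope ring_scope.
Local Open Scope charge_scope.

(** * Random bits and distinct indices *)

(** The [#|K|] bits read through an injection are determined, the other
    [M - #|K|] bits are free. *)
Lemma card_extensions (K : finType) M (J : {ffun K -> 'I_M})
    (e : K -> bool) : injective J ->
  (#|[pred s : {ffun 'I_M -> bool} | [forall c, s (J c) == e c]]| * 2 ^ #|K|
   = 2 ^ M)%N.
Proof.
move=> J_inj.
pose F (j : 'I_M) := [pred b : bool | [forall c, (J c == j) ==> (b == e c)]].
have -> : #|[pred s : {ffun 'I_M -> bool} | [forall c, s (J c) == e c]]| =
    #|family F|.
  apply: eq_card => s; rewrite inE; apply/forallP/familyP => h.
    by move=> j; rewrite !inE; apply/forallP => c; apply/implyP => /eqP <-.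
  by move=> c; have := h (J c); rewrite !inE => /forallP/(_ c)/implyP; apply.
rewrite card_family foldrE big_map big_enum/=.
have cF j : #|F j| = (if j \in [predC codom J] then 2 else 1)%N.
  rewrite !inE; case: ifPn => [jJ|/negPn/codomP[c ->]].
    rewrite -card_bool; apply: eq_card => b; rewrite !inE.
    apply/forallP => c; apply/implyP => /eqP jE.
    by move: jJ; rewrite -jE codom_f.
  rewrite -(card1 (e c)); apply: eq_card => b; rewrite !inE.
  apply/forallP/eqP => [/(_ c)|-> c']; first by rewrite eqxx => /eqP.
  by apply/implyP => /eqP/J_inj ->.
rewrite (eq_bigr _ (fun j _ => cF j)) -big_mkcond/= prod_nat_const.
by rewrite -(card_codom J_inj) -expnD addnC cardC card_ord.
Qed.

Lemma bernoulli_ineq (R : realDomainType) (x : R) k : 0 <= x <= 1 ->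
  1 - x *+ k <= (1 - x) ^+ k.
Proof.
move=> /andP[x0 x1]; elim: k => [|k IH]; first by rewrite mulr0n subr0 expr0.
rewrite exprSr; apply: le_trans (ler_wpM2r _ IH); last by rewrite subr_ge0.
have -> : (1 - x *+ k) * (1 - x) = 1 - x *+ k.+1 + x * (x *+ k).
  by rewrite mulrS; move: (x *+ k) => y; ring.
by rewrite lerDl mulr_ge0// mulrn_wge0.
Qed.

Lemma ffact_ge_exp M k : ((M - k) ^ k <= M ^_ k)%N.
Proof.
rewrite ffact_prod -[X in (_ ^ X)%N](card_ord k) -prod_nat_const.
by apply: leq_prod => i _; rewrite leq_sub2l// ltnW.
Qed.

(** The birthday bound: [k] independent uniform draws among [M] values are
    pairwise distinct with probability at least [1 - k ^ 2 / M]. *)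
Lemma ffact_ratio_ge (R : realFieldType) M k : (k <= M)%N -> (0 < M)%N ->
  1 - (k ^ 2)%:R / M%:R <= (M ^_ k)%:R / M%:R ^+ k :> R.
Proof.
move=> kM M0; have M0' : 0 < M%:R :> R by rewrite ltr0n.
have hx : 0 <= (k%:R / M%:R : R) <= 1.
  by rewrite ler_pdivrMr// mul1r ler_nat kM divr_ge0.
have := bernoulli_ineq k hx.
rewrite -[(_ / _) *+ _]mulr_natr mulrAC -natrM mulnn => /le_trans; apply.
rewrite -[X in (X - _) ^+ _](divff (lt0r_neq0 M0')) -mulrBl -natrB//.
rewrite expr_div_n -[(M - k)%:R ^+ k]natrX.
by rewrite ler_wpM2r// ?ler_nat ?ffact_ge_exp// invr_ge0 exprn_ge0.
Qed.

Lemma ex_ge_average (R : realDomainType) (I : finType) (F : I -> R) (v : R) :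
  (0 < #|I|)%N -> v *+ #|I| <= \sum_i F i -> exists i, v <= F i.
Proof.
move=> /card_gt0P[i0 _] vF; apply: contrapT => /forallNP h.
move: vF; apply/negP; rewrite -ltNge -sumr_const; apply: ltr_sum => [|i _].
  by apply/hasP; exists i0 => //; rewrite mem_index_enum.
by rewrite ltNge; apply/negP/h.
Qed.

(** The combinatorial core. An outcome [w] records for each of the observations
    [c : K] an index [w.1 c] and a bit [w.2 c]; [t c] tells from which of the
    two samples [c] comes, so that under the split [s] the bit observed at
    [c] has to be [s (w.1 c) (+) t c]. The function [g] plays the test: the
    first sum bounds its error of the first kind under the null, the second one
    its error of the second kind under the split [s]. Averaging the second sum
    over all [s] turns its weights into those of the first one. *)
Lemma birthday_mixture (R : realFieldType) (K : finType) m (t : K -> bool)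
    (g : {ffun K -> 'I_m.+1} * {ffun K -> bool} -> R) :
  (#|K| <= m.+1)%N ->
  exists s : {ffun 'I_m.+1 -> bool},
    1 - (#|K| ^ 2)%:R / m.+1%:R <=
    \sum_(w : {ffun K -> 'I_m.+1} * {ffun K -> bool} | injectiveb w.1)
       g w * (2 * m.+1%:R)^-1 ^+ #|K| +
    \sum_(w : {ffun K -> 'I_m.+1} * {ffun K -> bool} |
          injectiveb w.1 && [forall c, s (w.1 c) == w.2 c (+) t c])
       (1 - g w) * m.+1%:R^-1 ^+ #|K|.
Proof.
move=> Km; set k := #|K|; set M := m.+1%:R : R.
set A := \sum_(w | _) _; apply: ex_ge_average.
  by rewrite card_ffun card_bool expn_gt0.
rewrite big_split/= sumr_const.
have -> : \sum_(s : {ffun 'I_m.+1 -> bool})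
      \sum_(w : {ffun K -> 'I_m.+1} * {ffun K -> bool} |
            injectiveb w.1 && [forall c, s (w.1 c) == w.2 c (+) t c])
        (1 - g w) * M^-1 ^+ k =
    (\sum_(w : {ffun K -> 'I_m.+1} * {ffun K -> bool} | injectiveb w.1)
       (1 - g w) * (2 * M)^-1 ^+ k) *+ #|{ffun 'I_m.+1 -> bool}|.
  rewrite (exchange_big_dep (fun w : {ffun K -> 'I_m.+1} * {ffun K -> bool} =>
    injectiveb w.1))/=; last by move=> ? ? _ /andP[].
  rewrite -sumrMnl; apply: eq_bigr => w /injectiveP w_inj.
  rewrite sumr_const card_ffun card_bool card_ord.
  rewrite -(card_extensions (fun c => w.2 c (+) t c) w_inj).
  rewrite (eq_card (B := [pred s : {ffun 'I_m.+1 -> bool} |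
      [forall c, s (w.1 c) == w.2 c (+) t c]])) => [|s]; last first.
    by rewrite !inE; move/injectiveP: w_inj => ->.
  have -> : M^-1 ^+ k = (2 * M)^-1 ^+ k *+ 2 ^ k.
    rewrite -[RHS]mulr_natr natrX -exprMn invfM mulrAC.
    by rewrite mulVf ?mul1r ?pnatr_eq0.
  by rewrite mulrnAr -mulrnA mulnC.
rewrite -mulrnDl lerMn2r; apply/orP; right.
rewrite -big_split/= (eq_bigr (fun=> (2 * M)^-1 ^+ k)) => [|w _]; last first.
  by rewrite -mulrDl addrC subrK mul1r.
rewrite sumr_const.
have -> : #|[pred w : {ffun K -> 'I_m.+1} * {ffun K -> bool} | injectiveb w.1]|
    = (m.+1 ^_ k * 2 ^ k)%N.
  rewrite -[in RHS](card_ord m.+1) -card_inj_ffuns -card_bool -card_ffun cardsE.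
  rewrite -cardX; apply: eq_card => -[J e].
  by rewrite !inE andbT.
apply: le_trans (ffact_ratio_ge R Km (ltn0Sn m)) _.
rewrite -[leRHS]mulr_natr natrM [(2 ^ k)%:R]natrX mulrCA -exprMn.
by rewrite invfM mulrAC mulVf ?mul1r ?pnatr_eq0// exprVn.
Qed.

(** * Finitely supported laws *)

Section uniform.
Context d (T : measurableType d) (R : realType) (m : nat).
Local Open Scope ereal_scope.
Implicit Type a : 'I_m.+1 -> T.

(** Points are repeated according to their multiplicity in [a]; the total mass
    is 1 even when [a] is not injective. *)
Definition uniform_on a : set T -> \bar R :=
  mscale (m.+1%:R^-1%R)%:nng%R (msum (fun k => \d_(a (inord k))) m.+1).

Lemma uniform_onE a A :
  uniform_on a A = (m.+1%:R^-1)%:E * \sum_(j < m.+1) \d_(a j) A.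
Proof.
rewrite /uniform_on /mscale /msum; congr (_ * _).
by apply: eq_bigr => j _; rewrite inord_val.
Qed.

HB.instance Definition _ a := Measure.on (uniform_on a).

Let uniform_on_setT a : uniform_on a setT = 1.
Proof.
rewrite uniform_onE (eq_bigr (fun=> 1)) => [|j _]; last by rewrite diracT.
by rewrite sumEFin -EFinM big_const_ord iter_addr_0 mulVf.
Qed.

HB.instance Definition _ a :=
  Measure_isProbability.Build _ _ _ (uniform_on a) (uniform_on_setT a).

Lemma uniform_on_atom a j : injective a ->
  uniform_on a [set a j] = (m.+1%:R^-1)%:E.
Proof.
move=> a_inj; rewrite uniform_onE (bigD1 j)//= diracE mem_set//.
rewrite big1 ?adde0 ?mule1// => k kj; rewrite diracE memNset//= => /a_inj /eqP.
by rewrite (negPf kj).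
Qed.

Lemma uniform_on_off a A : (forall j, ~ A (a j)) -> uniform_on a A = 0.
Proof.
move=> Aa; rewrite uniform_onE big1 ?mule0// => j _.
by rewrite diracE memNset//; exact: Aa.
Qed.

End uniform.

Lemma expectation_ge_atoms d (X : measurableType d) (R : realType)
    (P : probability X R) (W : finType) (D : pred W) (z : W -> X) (g : X -> R) :
  (forall w, measurable [set z w]) -> {in D &, injective z} ->
  measurable_fun setT g -> (forall x, 0 <= g x) ->
  (\sum_(w | D w) (g (z w))%:E * P [set z w] <= 'E_P[g])%E.
Proof.
move=> mz z_inj mg g0.
have <- : ('E_P[fun x => (\sum_(w | D w) g (z w) * \1_[set z w] x)%R])%E =
    (\sum_(w | D w) (g (z w))%:E * P [set z w])%E.
  rewrite unlock; under eq_integral do rewrite -sumEFin -big_filter.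
  rewrite ge0_integral_sum//=.
  - rewrite big_filter; apply: eq_bigr => w _.
    under eq_integral do rewrite EFinM.
    rewrite ge0_integralZl_EFin//; first by rewrite integral_indic// setIT.
    by apply/measurable_EFinP; exact: measurable_indic.
  - move=> w; apply/measurable_EFinP/measurable_funM => //;
    exact: measurable_indic.
  - by move=> w x _; rewrite lee_fin mulr_ge0.
apply: expectation_le => //.
- under eq_fun do rewrite -big_filter.
  apply: measurable_sum => w; apply: measurable_funM => //;
  exact: measurable_indic.
- by move=> x; apply: sumr_ge0 => w _; rewrite mulr_ge0.
apply/aeW => x /=.
have [[w Dw zw]|h] := pselect (exists2 w, D w & z w = x).
  rewrite (bigD1 w)//= big1 => [|w' /andP[Dw' w'w]].
    by rewrite addr0 indicE mem_set// mulr1 zw.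
  rewrite indicE memNset/= ?mulr0// -zw => /z_inj ww.
  by rewrite ww ?inE ?eqxx in w'w.
rewrite big1// => w Dw; rewrite indicE memNset/= ?mulr0// => xw.
by apply: h; exists w.
Qed.

Lemma tuple_set1 T n (x : n.-tuple T) :
  [set x] = [set y | forall i, [set tnth x i] (tnth y i)].
Proof. by apply/seteqP; split => [y -> i//|y h]; apply/eq_from_tnth. Qed.

Lemma measurable_tuple_set1 d (T : measurableType d) n (x : n.-tuple T) :
  (forall i, measurable [set tnth x i]) -> measurable [set x].
Proof.
move=> mx; rewrite tuple_set1.
rewrite (_ : mkset _ = \bigcap_(i in [set: 'I_n])
    (fun y : n.-tuple T => tnth y i) @^-1` [set tnth x i]).
  apply: fin_bigcap_measurable => // i _.
  by rewrite -[X in measurable X]setTI; exact: measurable_tnth.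
by apply/seteqP; split => y /= h i; [move=> _|]; exact: h.
Qed.

Lemma measurable_pair_set1 d1 d2 (T1 : measurableType d1)
    (T2 : measurableType d2) (x : T1 * T2) :
  measurable [set x.1] -> measurable [set x.2] -> measurable [set x].
Proof.
move=> m1 m2; rewrite (_ : [set x] = [set x.1] `*` [set x.2]).
  exact: measurableX.
by apply/seteqP; split => [y -> //|[y1 y2] [/= -> ->]]; case: x {m1 m2}.
Qed.

Lemma prob_pow_atom d (T : measurableType d) (R : realType)
    (P Q : probability T R) n (x y : n.-tuple T) :
  (forall t : T, measurable [set t]) ->
  (prob_pow P n \x prob_pow Q n)%E [set (x, y)] =
    ((\prod_(i < n) P [set tnth x i]) * \prod_(i < n) Q [set tnth y i])%E.
Proof.
move=> m1; rewrite (_ : [set (x, y)] = [set x] `*` [set y]); last first.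
  by apply/seteqP; split => [_ -> //|[u v] [/= -> ->]].
rewrite product_measure1E; [|exact: measurable_tuple_set1..].
rewrite tuple_set1 (tuple_set1 y); congr (_ * _)%E.
  exact: (prob_pow_rect P (A := fun i => [set tnth x i])).
exact: (prob_pow_rect Q (A := fun i => [set tnth y i])).
Qed.

(** * Membership in the two hypotheses *)

(** No test of [P] against itself beats guessing: its two errors sum to 1. *)
Lemma succeq_diag d (T : measurableType d) (R : realType)
    (P : probability T R) (f : R -> R) :
  (forall a : R, a \in `[0, 1] -> f a <= 1 - a) -> succeq (tradeoff P P) f.
Proof.
move=> f1 a a01; apply: le_ereal_inf_tmp => _ [phi [[mphi phi01] phia] <-].
have E1 : ('E_P[phi] + 'E_P[fun x => (1 - phi x)%R] = 1)%E.
  rewrite unlock -(@ge0_integralD _ _ _ _ _ measurableT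
    (EFin \o phi) (fun x => (1 - phi x)%:E))//=.
  - rewrite (eq_integral (cst 1%E)) => [|x _].
      by rewrite integral_cst//= probability_setT mule1.
    by rewrite -EFinD addrC subrK.
  - by move=> x _; rewrite lee_fin; case/andP: (phi01 x).
  - exact/measurable_EFinP.
  - by move=> x _; rewrite lee_fin subr_ge0; case/andP: (phi01 x).
  - by apply/measurable_EFinP; exact: measurable_funB.
apply: (@le_trans _ _ (1 - a)%:E); first by rewrite lee_fin f1.
rewrite EFinB leeBlDl// -[leLHS]E1; exact: leeD2r.
Qed.

Lemma nsucceq_singular d (T : measurableType d) (R : realType)
    (P Q : probability T R) (f : R -> R) (C : set T) :
  measurable C -> P C = 0%E -> Q (~` C) = 0%E -> 0 < f 0 ->
  nsucceq (tradeoff P Q) f.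
Proof.
move=> mC PC QC f0; exists 0; first by rewrite in_itv/= lexx ler01.
apply: le_lt_trans (_ : 0 < _)%E; last by rewrite lte_fin.
apply: ereal_inf_lbound; exists \1_C.
  split; last by rewrite expectation_indic// PC.
  split; first exact: measurable_indic.
  by move=> x; rewrite indicE; case: (_ \in _); rewrite ?lexx ?ler01.
rewrite -QC -expectation_indic; last exact: measurableC.
congr expectation; apply/funext => x; rewrite !indicE in_setC.
by case: (_ \in _); rewrite ?subrr ?subr0.
Qed.

(** * Attainability of atomic laws *)

Lemma Radon_Nikodym_atom d (T : measurableType d) (R : realType)
    (nu : {charge set T -> \bar R})
    (mu : {sigma_finite_measure set T -> \bar R}) x :
  measurable [set x] -> nu `<< mu ->
  nu [set x] = ('d nu '/d mu x * mu [set x])%E.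
Proof.
move=> mx numu; rewrite (Radon_Nikodym_integral numu mx).
rewrite -(integral_cst _ mx); apply: eq_integral => y.
by rewrite inE => ->.
Qed.

(** At an atom of the mixture, densities are masses divided by the positive
    mass of that atom, and likelihood-ratio sets are insensitive to a common
    positive factor: the masses can stand for the densities. *)
Lemma attainable_on_atoms d (T : measurableType d) (R : realType)
    (S : set (set T)) (P Q : probability T R) (E : set T) :
  measurable E -> mixture P Q (~` E) = 0%E ->
  (forall x, E x -> measurable [set x] /\ (0 < mixture P Q [set x])%E) ->
  (forall lambda, (0 <= lambda)%E -> exists2 B, S B &
     forall x, E x ->
       (B x <->
        lr_set (fun x => P [set x]) (fun x => Q [set x]) lambda x)) ->
  attainable S P Q.
Proof.
move=> mE muE atomE SE mu p q lambda l0.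
have [B SB BE] := SE lambda l0; exists B => //.
exists (~` E); split => //; first exact: measurableC.
move=> x /=; apply: contra_not => Ex.
have [mx mux] := atomE _ Ex.
have Px : P [set x] = (p x * mixture P Q [set x])%E :=
  Radon_Nikodym_atom (nu := charge_of_finite_measure P) mx
    (@mixture_dominatesl _ _ _ P Q).
have Qx : Q [set x] = (q x * mixture P Q [set x])%E :=
  Radon_Nikodym_atom (nu := charge_of_finite_measure Q) mx
    (@mixture_dominatesr _ _ _ P Q).
have {}BE : B x <-> lr_set p q lambda x.
  apply: (iff_trans (BE x Ex)); rewrite /lr_set; case: ifPn => /= _.
    rewrite Px; split=> [/eqP|->]; last by rewrite mul0e.
    by rewrite mule_eq0 [X in _ || X]gt_eqF// orbF => /eqP.
  by rewrite Px Qx muleA lte_pmul2r// fin_num_measure.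
rewrite !indicE; congr (_%:R); congr nat_of_bool.
by apply/idP/idP; rewrite !inE => /BE.
Qed.

(** The likelihood ratio is constantly 1, so only [setT] and [set0] occur. *)
Lemma attainable_diag d (T : measurableType d) (R : realType)
    (S : set (set T)) (P : probability T R) (E : set T) :
  S set0 -> S setT -> measurable E -> P (~` E) = 0%E ->
  (forall x, E x -> measurable [set x] /\ (0 < P [set x])%E) ->
  attainable S P P.
Proof.
move=> S0 ST mE PE Epos.
have mixP A : measurable A -> mixture P P A = P A.
  move=> mA; have : P A \is a fin_num by exact: fin_num_measure.
  rewrite mixtureE; case: (P A) => // r _; rewrite -EFinD -EFinM.
  congr EFin; rewrite -[(r + r)%R]mulr2n -[(r *+ 2)%R]mulr_natl.
  by rewrite mulrA mulVf ?mul1r.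
apply: (attainable_on_atoms mE) => [|x Ex|l l0].
- by rewrite mixP//; exact: measurableC.
- by have [mx Px] := Epos x Ex; split; rewrite ?mixP.
have [l1|l1] := ltP l 1%E.
  exists setT => // x /Epos[mx Px]; split => // _; rewrite /lr_set.
  rewrite lt_eqF ?(lt_trans l1 (ltry _))//= -[ltRHS]mul1e lte_pmul2r//.
  exact: fin_num_measure.
exists set0 => // x /Epos[mx Px]; split => //; rewrite /lr_set.
case: ifPn => _ /=; first by move=> Px0; move: Px; rewrite Px0 ltxx.
rewrite -[ltRHS]mul1e lte_pmul2r//; last exact: fin_num_measure.
by rewrite ltNge l1.
Qed.

(** * Shattered families of points *)

(** Traces on a finite set [A] form a subset of its power set; when their
    number is the size of the power set, every subset is a trace. *)
Lemma shattered_injection (R : realType) (T : choiceType) (S : set (set T))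
    (I : finType) :
  VC_dim R S = +oo%E -> exists2 a : I -> T, injective a &
    forall C : pred I, exists2 B, S B & forall i, B (a i) <-> C i.
Proof.
move=> VC.
have [_ [A shA <-]] : exists2 y, [set (#|` A|%:R)%:E | A in shattered S] y &
    ((#|I|%:R)%:E < y :> \bar R)%E.
  by apply: ereal_sup_gt; rewrite -/(VC_dim R S) VC ltry.
rewrite lte_fin ltr_nat => IA.
have sub C : [set` A] `&` C `<=` [set` A] by exact: subIsetl.
have finA : finite_set [set` A] by exact: finite_fset.
pose G := [set [set` A] `&` B | B in S].
have finG : finite_set G by exists (2 ^ #|` A|)%N.
have GA : ((@fset_set T) @` G) = [set` fpowerset A].
  have finH : finite_set ((@fset_set T) @` G) by exact: finite_image.
  rewrite -[LHS]fset_setK//.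
  suff -> : fset_set ((@fset_set T) @` G) = fpowerset A by [].
  apply/eqP.
  rewrite eqEfcard card_fpowerset fset_set_image// card_in_imfset/=; last first.
    move=> U V; rewrite !in_fset_set// !inE => -[U' _ <-] [V' _ <-].
    by apply: fset_set_inj; apply: sub_finite_set finA.
  rewrite (card_fset_set shA) leqnn andbT.
  apply/fsubsetP => U /imfsetP[V/=]; rewrite in_fset_set// inE => -[B _ <-] ->.
  rewrite fpowersetE; apply/fsubsetP => y.
  by rewrite in_fset_set; [rewrite inE => -[]|exact: sub_finite_set finA].
(* x0 is a default value for nth, which is only used below the size of A *)
have [x0 _] : exists x, x \in A.
  by apply/fset0Pn; rewrite -cardfs_gt0; exact: leq_ltn_trans IA.
pose a (i : I) := nth x0 A (enum_rank i).
have aA i : a i \in A by rewrite mem_nth// (leq_trans (ltn_ord _))// ltnW.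
have a_inj : injective a.
  move=> i j /eqP.
  rewrite nth_uniq//; try by rewrite (leq_trans (ltn_ord _))// ltnW.
  by move=> /eqP/val_inj/enum_rank_inj.
exists a => // C.
have : [set` fpowerset A] [fset a i | i in C]%fset.
  by rewrite /= fpowersetE; apply/fsubsetP => _ /imfsetP[i _ ->].
rewrite -GA => -[_ [B SB <-] BC]; exists B => // i.
have -> : B (a i) <-> a i \in fset_set ([set` A] `&` B).
  rewrite in_fset_set; last exact: sub_finite_set finA.
  by rewrite inE/=; split => [|[]].
rewrite BC; split => [/imfsetP[j Cj /a_inj ->]//|Ci].
exact: in_imfset.
Qed.

(** * The lower bound from one shattered family *)

Section shattered_family.
Context d (T : measurableType d) (R : realType) (S : set (set T)).
Hypothesis meas1 : forall x : T, measurable [set x].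
Hypotheses (S0 : S set0) (ST : S setT).
Variables (m : nat) (a : 'I_m.+1 * bool -> T).
Hypothesis a_inj : injective a.
Hypothesis a_shattered : forall C : pred ('I_m.+1 * bool),
  exists2 B, S B & forall i, B (a i) <-> C i.
Local Open Scope ereal_scope.

Definition half (s : 'I_m.+1 -> bool) : probability T R :=
  uniform_on R (fun j => a (j, s j)).

Let M : R := m.+1%:R.

Let half_atom s j b :
  half s [set a (j, b)] = (if b == s j then M^-1 else 0)%:E.
Proof.
case: eqP => [->|bs].
  by apply: (@uniform_on_atom _ _ R _ (fun j => a (j, s j))) => k l /a_inj[].
by apply: uniform_on_off => k /= /a_inj[-> /esym].
Qed.

Let half_mixture_atom s i :
  mixture (half s) (half (negb \o s)) [set a i] = ((2 * M)^-1)%:E.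
Proof.
case: i => j b; rewrite mixtureE !half_atom -EFinD -EFinM /=; congr (_%:E).
by case: b (s j) => -[]; rewrite /= ?addr0 ?add0r invfM.
Qed.

Let half_off s : half s (~` range a) = 0.
Proof. by apply: uniform_on_off => j; apply; exists (j, s j). Qed.

Let measurable_range_atoms : measurable (range a).
Proof.
by apply: countable_measurable => //; apply/finite_set_countable/finite_image.
Qed.

Let invM2_gt0 : (0 < (2 * M)^-1)%R.
Proof. by rewrite invr_gt0 mulr_gt0. Qed.

Lemma attainable_halves s : attainable S (half s) (half (negb \o s)).
Proof.
apply: (attainable_on_atoms measurable_range_atoms).
- by rewrite mixtureE !half_off adde0 mule0.
- move=> _ [i _ <-]; rewrite half_mixture_atom; split; first exact: meas1.
  by rewrite lte_fin invM2_gt0.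
move=> l l0; have [B SB BC] := a_shattered (fun i => i.2 != s i.1).
exists B => // _ [[j b] _ <-]; rewrite /lr_set.
apply: (iff_trans (BC (j, b))) => /=.
have M0 : (0 < M^-1)%R by rewrite invr_gt0.
case: ifPn => _ /=; rewrite !half_atom /=.
  by case: b (s j) => -[] /=; split => // -[] /eqP; rewrite gt_eqF.
case: b (s j) => -[] /=; split => //; rewrite ?mule0 ?lte_fin//.
  by rewrite ltNge mule_ge0// lee_fin ltW.
by rewrite ltNge mule_ge0// lee_fin ltW.
Qed.

Variables (n : nat) (psi : n.-tuple T * n.-tuple T -> R) (f0 f1 : R -> R).
Hypotheses (psi_test : is_test psi).
Hypothesis f0_le : forall x : R, x \in `[0%R, 1%R] -> (f0 x <= 1 - x)%R.
Hypothesis f1_gt0 : (0 < f1 0)%R.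
Hypothesis n_le_m : (n + n <= m.+1)%N.

Let K : finType := ('I_n + 'I_n)%type.
Let W : finType := ({ffun K -> 'I_m.+1} * {ffun K -> bool})%type.

Let cell (w : W) (c : K) : T := a (w.1 c, w.2 c).
Let z (w : W) : n.-tuple T * n.-tuple T :=
  ([tuple cell w (inl i) | i < n], [tuple cell w (inr i) | i < n]).

Let z_inj : injective z.
Proof.
move=> [J e] [J' e'] zz.
have h c : (J c, e c) = (J' c, e' c).
  apply: a_inj; case: c => i.
    by have := congr1 (fun u => tnth u.1 i) zz; rewrite !tnth_mktuple.
  by have := congr1 (fun u => tnth u.2 i) zz; rewrite !tnth_mktuple.
by congr (_, _); apply/ffunP => c; have [] := h c.
Qed.

(** The split [s] provided by [birthday_mixture] for the rejection
    probabilities [psi \o z] gives the pair on which the test does badly; both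
    errors are bounded below by their contribution from outcomes with pairwise
    distinct indices. *)
Lemma err_sum_ge_birthday :
  (1 - ((n + n) ^ 2)%:R / M)%:E <=
  err_I (attainable_pairs S) f0 psi + err_II (attainable_pairs S) f1 psi.
Proof.
have [mpsi psi01] := psi_test.
have cardK : #|K| = (n + n)%N by rewrite card_sum !card_ord.
have [|s] := @birthday_mixture R K m
  (fun c => if c is inr _ then true else false) (psi \o z).
  by rewrite cardK.
rewrite cardK -/M => /= Hs.
have mz w : measurable [set z w].
  by apply: measurable_pair_set1; apply: measurable_tuple_set1.
apply: (@le_trans _ _ (_%:E)); first by rewrite lee_fin; exact: Hs.
rewrite EFinD; apply: leeD.
- pose U := mixture (half s) (half (negb \o s)) : probability T R.
  have U_atom i : U [set a i] = ((2 * M)^-1)%:E := half_mixture_atom s i.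
  have U_off : U (~` range a) = 0.
    by rewrite [LHS]mixtureE !half_off adde0 mule0.
  apply: (@le_trans _ _ ('E_(prob_pow U n \x prob_pow U n)[psi])); last first.
    apply: ereal_sup_ubound; exists (U, U) => //.
    split; last exact: succeq_diag.
    apply: (attainable_diag S0 ST measurable_range_atoms U_off) => _ [i _ <-].
    by split; [exact: meas1|rewrite U_atom lte_fin invM2_gt0].
  apply: le_trans (expectation_ge_atoms _
    (D := fun w : W => injectiveb w.1) mz (in2W z_inj) mpsi _); last first.
    by move=> x; case/andP: (psi01 x).
  rewrite -sumEFin; apply: lee_sum => w _.
  rewrite [X in _ <= _ * X](@prob_pow_atom _ _ _ _ _ _
    [tuple cell w (inl i) | i < n] [tuple cell w (inr i) | i < n])// EFinM.
  under eq_bigr do rewrite tnth_mktuple U_atom.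
  under [X in _ * (_ * X)]eq_bigr do rewrite tnth_mktuple U_atom.
  by rewrite !prodEFin !prodr_const card_ord exprD [(_ ^+ n * _)%:E]EFinM.
- pose P := half s; pose Q := half (negb \o s).
  apply: (@le_trans _ _
    ('E_(prob_pow P n \x prob_pow Q n)[fun x => (1 - psi x)%R])); last first.
    apply: ereal_sup_ubound; exists (P, Q) => //.
    split; first exact: attainable_halves.
    pose C := range (fun j => a (j, ~~ s j)).
    apply: (@nsucceq_singular _ _ _ (half s) (half (negb \o s)) _ C) => //.
    + apply: countable_measurable => //.
      exact/finite_set_countable/finite_image/finite_finset.
    + by apply: uniform_on_off => j [k _ /a_inj[->]]; case: (s j).
    + by apply: uniform_on_off => j; apply; exists j.
  apply: le_trans (expectation_ge_atoms _
    (D := fun w : W => injectiveb w.1 && _) mz (in2W z_inj) _ _); last first.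
  + by move=> x; rewrite subr_ge0; case/andP: (psi01 x).
  + exact: measurable_funB.
  rewrite -sumEFin; apply: lee_sum => w /andP[_ /forallP agree].
  rewrite [X in _ <= _ * X](@prob_pow_atom _ _ _ _ _ _
    [tuple cell w (inl i) | i < n] [tuple cell w (inr i) | i < n])// EFinM.
  under eq_bigr => i _.
    rewrite tnth_mktuple half_atom.
    move/eqP: (agree (inl i)) => ->; rewrite addbF eqxx.
    over.
  under [X in _ * (_ * X)]eq_bigr => i _.
    rewrite tnth_mktuple half_atom /=.
    move/eqP: (agree (inr i)) => ->; rewrite addbT negbK eqxx.
    over.
  by rewrite !prodEFin !prodr_const card_ord exprD [(_ ^+ n * _)%:E]EFinM.
Qed.

End shattered_family.

(** * Infinite VC dimension *)

Lemma err_sum_ge1 d (T : measurableType d) (R : realType) (S : set (set T))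
    (n : nat) (psi : n.-tuple T * n.-tuple T -> R) (f0 f1 : R -> R) :
  (forall x : T, measurable [set x]) -> S set0 -> S setT ->
  VC_dim R S = +oo%E -> is_test psi ->
  tradeoff_function f0 -> 0 < f1 0 ->
  (1 <= err_I (attainable_pairs S) f0 psi
        + err_II (attainable_pairs S) f1 psi)%E.
Proof.
move=> meas1 S0 ST VC psi_test [_ _ _ _ f0_le] f1_gt0.
apply/lee_subgt0Pr => e e0.
set x : R := ((n + n) ^ 2)%:R / e.
(* the first summand makes the birthday error at most e, the second one leaves
   room for 2 n distinct indices *)
pose m := (Num.trunc x + (n + n))%N.
have [a a_inj a_sh] := shattered_injection ('I_m.+1 * bool)%type VC.
have nm : (n + n <= m.+1)%N by rewrite leqW// leq_addl.
apply: le_trans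
  (err_sum_ge_birthday meas1 S0 ST a_inj a_sh psi_test f0_le f1_gt0 nm).
rewrite -EFinB lee_fin lerD2l lerN2 ler_pdivrMr ?ltr0n// mulrC -ler_pdivrMr//.
apply: (le_trans (ltW (truncnS_gt x))).
by rewrite ler_nat ltnS leq_addr.
Qed.

Lemma measurable_euclid_set1 (R : realType) n (x : euclid R n) :
  measurable [set x].
Proof.
rewrite -[X in measurable X]setCK; apply: measurableC; apply: sub_gen_smallest.
apply: closed_openC.
rewrite (_ : [set x] = \bigcap_(i in [set: 'I_n])
    (fun v : 'rV[R]_n => v ord0 i) @^-1` [set y | y = x ord0 i]).
  apply: closed_bigI => i _.
  by apply: preimage_closed => // v _; exact: coord_continuous.
apply/seteqP; split => [v -> i//|v h]; apply/rowP => i; exact: h.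
Qed.

Theorem theorem4p1 (R : realType) (n : nat) (f0 f1 : R -> R) :
  (1 <= n)%N ->
  tradeoff_function f0 -> tradeoff_function f1 -> 0 < f1 0 ->
  (forall (d : nat) (S : set (set (euclid R d)))
          (psi : n.-tuple (euclid R d) * n.-tuple (euclid R d) -> R),
     (forall B, S B -> measurable B) -> S set0 -> S setT ->
     VC_dim R S = +oo%E ->
     is_test psi ->
     (1 <= err_I (attainable_pairs S) f0 psi
           + err_II (attainable_pairs S) f1 psi)%E) /\
  (forall (S : set (set int)) (psi : n.-tuple int * n.-tuple int -> R),
     (forall B, S B -> measurable B) -> S set0 -> S setT ->
     VC_dim R S = +oo%E ->
     is_test psi ->
     (1 <= err_I (attainable_pairs S) f0 psi
           + err_II (attainable_pairs S) f1 psi)%E).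
Proof.
move=> _ f0T _ f1_gt0; split => [d S psi _ S0 ST VC ptest|S psi _ S0 ST VC ptest].
  by apply: err_sum_ge1 => // x; exact: measurable_euclid_set1.
by apply: err_sum_ge1.
Qed.
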